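(* Let $r$ be a positive integer and let $G$ be a finite simple graph in which every vertex has degree $r$ or $r+1$. Let $H\colon V(G)\to 2^{\mathbb{N}}$ be a function with $H(v)\subseteq\{0,1,\ldots,d_G(v)\}$ for every $v\in V(G)$. Put $mH=\min_{v\in V(G)}\min H(v)$ and $MH=\max_{v\in V(G)}\max H(v)$. If $mH\ge 1$, $MH\le r$, and \[ |H(v)|\ge \frac{MH-mH+3}{2}\qquad\text{for all } v\in V(G), \] then $G$ has an $H$-factor, i.e. a spanning subgraph $F$ of $G$ with $d_F(v)\in H(v)$ for every $v\in V(G)$.
   Context: $2^{\mathbb{N}}$ denotes the collection of sets of nonnegative integers, and $d_G(v)$ is the degree of $v$ in $G$. The sets $H(v)$ are assumed nonempty, so that $mH$ and $MH$ are defined. *)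

(* Defs.v *)
From mathcomp Require Import all_boot all_order all_algebra.
From mathcomp Require Import finmap.

Set Implicit Arguments.
Unset Strict Implicit.
Unset Printing Implicit Defensive.

Record simple_graph (V : finType) := SimpleGraph {
  adj :> rel V;
  adj_sym : symmetric adj;
  adj_irrefl : irreflexive adj
}.

Definition degree (V : finType) (G : simple_graph V) (v : V) : nat :=
  #|[set w | G v w]|.

(* Both graphs live on the whole of V, so a subgraph here is spanning. *)
Definition spanning_subgraph (V : finType) (F G : simple_graph V) : Prop :=
  subrel F G.

Definition is_factor (V : finType) (H : V -> {fset nat})
    (F G : simple_graph V) : Prop :=
  spanning_subgraph F G /\ forall v : V, degree F v \in H v.

Definition has_factor (V : finType) (H : V -> {fset nat})
    (G : simple_graph V) : Prop :=
  exists F : simple_graph V, is_factor H F G.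

(* minn has no neutral element: each iterated minimum below is seeded with an
   upper bound of the values it ranges over, which does not affect the result
   as soon as the range is nonempty (otherwise the result is the seed). *)
Definition fset_max (A : {fset nat}) : nat := \max_(k <- A) k.

Definition fset_min (A : {fset nat}) : nat :=
  \big[minn/fset_max A]_(k <- A) k.

Definition MH (V : finType) (H : V -> {fset nat}) : nat :=
  \max_(v : V) fset_max (H v).

Definition mH (V : finType) (H : V -> {fset nat}) : nat :=
  \big[minn/MH H]_(v : V) fset_min (H v).

(* Main.v *)
Require Import Defs.
From mathcomp Require Import all_boot all_order all_algebra.
From mathcomp Require Import finmap zify.

(* Write f = MH and g = mH, and let k be the ceiling of (f - g + 1) / 2, so that
   |H v| > k. If G splits into E, D and a rest, where D is oriented with all
   in-degrees at most k, deg E <= g and deg E + deg D >= f, then a greedy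
   procedure (Frank, Lau, Szabo) extends E by edges of D to an H-factor.
   To find E and D: in a graph with degrees r, r + 1, delete edges until the
   vertices of degree r + 1 are independent, and cover them by a matching N.
   Removing N gives degrees r - 1, r; iterating, degrees f, f + 1. If f is odd,
   an oriented form of Petersen's 2-factor theorem decomposes this graph into
   (f + 1) / 2 classes with in- and out-degrees at most 1, and k of them form D.
   If f is even, the graph has maximal degree f after one more removal of a
   matching N; decompose it into f / 2 classes and put N into E.
   Graphs are symmetric nat-valued matrices with zero diagonal. *)

(** * Hall's theorem and splittings of nonnegative integer matrices *)

(* Rado's proof: if some S x has two elements, one of them can be removed from it
   without violating Hall's condition. *)
Lemma hall_marriage (T U : finType) (S : T -> {set U}) :
    (forall X : {set T}, #|X| <= #|\bigcup_(x in X) S x|) ->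
  exists2 f : T -> U, injective f & forall x, f x \in S x.
Proof.
move: {2}(\sum_x _) (leqnn (\sum_x #|S x|)) => n.
elim: n S => [|n IHn] S leSn hallS.
  have T0 (x : T) : False.
    have := hallS [set x]; rewrite cards1 big_set1.
    by move: leSn; rewrite (bigD1 x) //=; lia.
  by exists (fun x => False_rect U (T0 x)) => x; case: (T0 x).
have [/existsP[x S_gt1]|/existsPn S_le1] := boolP [exists x, 1 < #|S x|].
  have [a [b [Sa Sb neq_ab]]] := card_gt1P S_gt1.
  pose cut c y := if y == x then S x :\ c else S y.
  have cutN c y : y != x -> cut c y = S y by rewrite /cut => /negPf->.
  have cutS c y : cut c y \subset S y.
    by rewrite /cut; case: eqP => [->|_] //; apply: subsetDl.
  have cut_IH c : c \in S x ->
      (forall X : {set T}, #|X| <= #|\bigcup_(y in X) cut c y|) ->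
      exists2 f : T -> U, injective f & forall y, f y \in S y.
    move=> Sc /(IHn (cut c))[|f injf fP]; last first.
      by exists f => // y; apply: (subsetP (cutS c y)).
    move: leSn; rewrite (bigD1 x) //= [X in _ -> X <= _](bigD1 x) //=.
    have -> : \sum_(y | y != x) #|cut c y| = \sum_(y | y != x) #|S y|.
      by apply: eq_bigr => y /cutN->.
    by rewrite {1}/cut eqxx (cardsD1 c (S x)) Sc; lia.
  have [/forallP|/forallPn[X ltX]] :=
    boolP [forall X : {set T}, #|X| <= #|\bigcup_(y in X) cut a y|].
    exact: cut_IH.
  have [/forallP|/forallPn[Y ltY]] :=
    boolP [forall X : {set T}, #|X| <= #|\bigcup_(y in X) cut b y|].
    exact: cut_IH.
  set P := \bigcup_(y in X) cut a y in ltX; set Q := \bigcup_(y in Y) cut b y in ltY.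
  have cut_mem c (Z : {set T}) :
      ~~ (#|Z| <= #|\bigcup_(y in Z) cut c y|) -> x \in Z.
    apply: contraNT => nZx; rewrite (eq_bigr S) ?hallS // => y Zy.
    by rewrite cutN //; apply: contraNneq nZx => <-.
  have [Xx Yx] := (cut_mem _ _ ltX, cut_mem _ _ ltY).
  (* Submodularity: as [a != b], [P :|: Q] contains even [S x], while [P :&: Q] contains the sets of
     all elements of [X :&: Y] other than [x]. Hall's condition gives
     [#|X| + #|Y| <= #|P| + #|Q| + 1], but the two violations force a gap of at least 2. *)
  have leU : #|X :|: Y| <= #|P :|: Q|.
    apply: leq_trans (hallS _) _; apply/subset_leq_card/bigcupsP => y XYy.
    apply/subsetP => z Sz; rewrite inE.
    have [eyx|nyx] := eqVneq y x.
      have [eza|nza] := eqVneq z a; apply/orP; [right|left];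
        apply/bigcupP; exists x => //.
        by rewrite /cut eqxx !inE -eyx Sz eza neq_ab.
      by rewrite /cut eqxx !inE -eyx Sz nza.
    by case/setUP: XYy => ?; apply/orP; [left|right]; apply/bigcupP; exists y => //;
      rewrite cutN.
  have leI : #|X :&: Y| <= #|P :&: Q|.+1.
    rewrite (cardsD1 x) !inE Xx Yx ltnS.
    apply: leq_trans (hallS _) _; apply/subset_leq_card/bigcupsP => y.
    rewrite !inE => /and3P[nyx Xy Yy]; apply/subsetP => z Sz; rewrite inE.
    by apply/andP; split; apply/bigcupP; exists y; rewrite ?cutN.
  by move: ltX ltY leU leI (cardsUI X Y) (cardsUI P Q); lia.
have S1 x : exists y, S x == [set y].
  have /cards1P[y ->] : #|S x| == 1; last by exists y.
  rewrite eqn_leq leqNgt S_le1 /=.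
  by have := hallS [set x]; rewrite cards1 big_set1.
exists (fun x => xchoose (S1 x)) => [x y eq_xy|x]; last first.
  by rewrite {2}(eqP (xchooseP (S1 x))) set11.
apply: contraTeq (hallS [set x; y]) => neq_xy.
rewrite cards2 neq_xy -ltnNge ltnS bigcup_setU !big_set1.
by rewrite (eqP (xchooseP (S1 x))) (eqP (xchooseP (S1 y))) eq_xy setUid cards1.
Qed.

(** Double counting gives Hall's condition: the rows in [X] carry weight [s.+1 * #|X|], all of it in
    the columns meeting their support, and each column has weight only [s.+1]. *)
Lemma regular_matrix_support_perm (T : finType) (s : nat) (A : T -> T -> nat) :
    (forall x, \sum_y A x y = s.+1) -> (forall y, \sum_x A x y = s.+1) ->
  exists2 f : T -> T, injective f & forall x, 0 < A x (f x).
Proof.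
move=> rowA colA.
have [|f injf fP] := hall_marriage T T (fun x => [set y | 0 < A x y]); last first.
  by exists f => // x; have := fP x; rewrite inE.
move=> X; set N := \bigcup_(x in X) _; rewrite -(leq_pmul2l (ltn0Sn s)) mulnC.
rewrite -sum_nat_const [X in _ <= X]mulnC -sum_nat_const.
rewrite -(eq_bigr _ (fun x _ => rowA x)) -(eq_bigr _ (fun y _ => colA y)).
apply: (@leq_trans (\sum_(x in X) \sum_(y in N) A x y)).
  apply: leq_sum => x Xx; rewrite (bigID (mem N)) /= [X in _ + X]big1 ?addn0 // => y.
  apply: contraNeq; rewrite -lt0n => Axy; apply/bigcupP; exists x => //.
  by rewrite inE.
by rewrite exchange_big; apply: leq_sum => y _; rewrite [X in _ <= X](bigID (mem X)) leq_addr.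
Qed.

Lemma sum_delta (T : finType) (a : T) (F : T -> nat) :
  \sum_x (x == a) * F x = F a.
Proof.
by rewrite (bigD1 a) //= eqxx mul1n big1 ?addn0 // => x /negPf->.
Qed.

(** Birkhoff's argument: a permutation matrix below [A] is subtracted [k] times, and [A1] collects
    these matrices. *)
Lemma regular_matrix_split (T : finType) (j k : nat) (A : T -> T -> nat) :
    (forall x, \sum_y A x y = j + k) -> (forall y, \sum_x A x y = j + k) ->
  exists A1 A2 : T -> T -> nat,
    [/\ forall x y, A x y = A1 x y + A2 x y,
        forall x, \sum_y A1 x y = k, forall y, \sum_x A1 x y = k,
        forall x, \sum_y A2 x y = j & forall y, \sum_x A2 x y = j].
Proof.
elim: k A => [|k IHk] A rowA colA.
  exists (fun _ _ => 0), A; split=> // z; first by rewrite big1.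
  - by rewrite big1.
  - by rewrite rowA addn0.
  - by rewrite colA addn0.
have [|y|f injf Af] := regular_matrix_support_perm T (j + k) A.
- by move=> x; rewrite rowA addnS.
- by rewrite colA addnS.
have [g fK gK] := injF_bij injf.
pose p x y : nat := y == f x.
have pE x y : p x y = (x == g y) by rewrite /p -(can2_eq fK gK) eq_sym.
have rowp x : \sum_y p x y = 1.
  by rewrite -(sum_delta _ (f x) (fun=> 1)); apply: eq_bigr => y _; rewrite muln1.
have colp y : \sum_x p x y = 1.
  rewrite -(sum_delta _ (g y) (fun=> 1)); apply: eq_bigr => x _.
  by rewrite muln1 pE.
have AE x y : A x y = p x y + (A x y - p x y).
  by rewrite subnKC // /p; case: eqP => // ->.
have [x|y|A1 [A2 [A12 rowA1 colA1 rowA2 colA2]]] := IHk (fun x y => A x y - p x y).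
- apply/eqP; rewrite -(eqn_add2l 1) -{1}(rowp x) -big_split /=.
  by rewrite -(eq_bigr _ (fun y _ => AE x y)) rowA addnS.
- apply/eqP; rewrite -(eqn_add2l 1) -{1}(colp y) -big_split /=.
  by rewrite -(eq_bigr _ (fun x _ => AE x y)) colA addnS.
exists (fun x y => p x y + A1 x y), A2; split=> //.
- by move=> x y; rewrite AE A12 addnA.
- by move=> x; rewrite big_split /= rowp rowA1.
- by move=> y; rewrite big_split /= colp colA1.
Qed.

(* The block matrix [[A, diag (s - row)], [diag (s - col), A^T]] has all row and
   column sums equal to s. *)
Lemma matrix_split (T : finType) (j k : nat) (A : T -> T -> nat) :
    (forall x, \sum_y A x y <= j + k) -> (forall y, \sum_x A x y <= j + k) ->
  exists A1 A2 : T -> T -> nat,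
    [/\ forall x y, A x y = A1 x y + A2 x y,
        forall x, \sum_y A1 x y <= k, forall y, \sum_x A1 x y <= k,
        forall x, \sum_y A2 x y <= j & forall y, \sum_x A2 x y <= j].
Proof.
move=> rowA colA; set s := j + k in rowA colA *.
pose M (a b : T + T) := match a, b with
  | inl x, inl y => A x y
  | inl x, inr y => (y == x) * (s - \sum_z A x z)
  | inr x, inl y => (y == x) * (s - \sum_z A z x)
  | inr x, inr y => A y x
  end.
have rowM a : \sum_b M a b = s.
  rewrite big_sumType /=; case: a => x /=.
    by rewrite (sum_delta _ _ (fun=> _)) subnKC.
  by rewrite (sum_delta _ _ (fun=> _)) subnK.
have colM b : \sum_a M a b = s.
  have deltaC (F : T -> nat) y : \sum_x (y == x) * F x = F y.
    by rewrite -(sum_delta _ y F); apply: eq_bigr => x _; rewrite eq_sym.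
  rewrite big_sumType /=; case: b => x /=.
    by rewrite deltaC subnKC.
  by rewrite deltaC subnK.
have [B1 [B2 [MB rowB1 colB1 rowB2 colB2]]] := regular_matrix_split _ j k M rowM colM.
exists (fun x y => B1 (inl x) (inl y)), (fun x y => B2 (inl x) (inl y)); split.
- by move=> x y; rewrite -MB.
- by move=> x; rewrite -(rowB1 (inl x)) big_sumType leq_addr.
- by move=> x; rewrite -(colB1 (inl x)) big_sumType leq_addr.
- by move=> x; rewrite -(rowB2 (inl x)) big_sumType leq_addr.
- by move=> x; rewrite -(colB2 (inl x)) big_sumType leq_addr.
Qed.

(** * Lowering the degrees of a near-regular graph by matchings *)

Definition arc (T : eqType) (a b u v : T) : nat := (u == a) && (v == b).

Lemma sum_arc_row (T : finType) (a b u : T) : \sum_v arc T a b u v = (u == a).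
Proof.
rewrite -[RHS](sum_delta _ b (fun=> (u == a) : nat)).
by apply: eq_bigr => v _; rewrite /arc mulnC mulnb.
Qed.

Lemma sum_arc_col (T : finType) (a b v : T) : \sum_u arc T a b u v = (v == b).
Proof. by rewrite -(sum_arc_row _ b a v); apply: eq_bigr => u _; rewrite /arc andbC. Qed.

(* Deleting edges between vertices of degree r + 1 makes these vertices
   independent; a matching N covering them is then given by matrix_split, since
   their rows have the maximal sum r + 1. *)
Lemma near_regular_matching (V : finType) (r : nat) (e : V -> V -> nat) :
    (forall u v, e u v = e v u) -> (forall v, e v v = 0) ->
    (forall v, r <= \sum_w e v w <= r.+1) ->
  exists K N : V -> V -> nat,
    [/\ forall u v, K u v = K v u, forall u v, N u v = N v u,
        forall u v, K u v + N u v <= e u v,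
        forall v, \sum_w N v w <= 1 &
        forall v, \sum_w K v w <= r <= \sum_w K v w + \sum_w N v w].
Proof.
have [n] := ubnP (\sum_u \sum_v e u v).
elim: n e => // n IHn e le_n syme loope dege.
pose W v := \sum_w e v w == r.+1.
have [/existsP[u /existsP[v /and3P[euv Wu Wv]]]|indep] :=
  boolP [exists u, exists v, [&& 0 < e u v, W u & W v]].
  have neq_uv : u != v by apply: contraTneq euv => ->; rewrite loope.
  pose p x y := arc V u v x y + arc V v u x y.
  have p_sym x y : p x y = p y x.
    by rewrite /p /arc addnC ![(x == _) && _]andbC.
  have rowp x : \sum_y p x y = (x == u) + (x == v).
    by rewrite big_split /= !sum_arc_row.
  have le_pe x y : p x y <= e x y.
    rewrite /p /arc; have [->|nxu] := eqVneq x u.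
      rewrite (negPf neq_uv) /= addn0; by case: eqP => // ->.
    rewrite add0n; case: eqP => // ->; case: eqP => //= ->; by rewrite syme.
  have eE x y : e x y = (e x y - p x y) + p x y by rewrite subnK.
  have rowe x : \sum_y e x y = \sum_y (e x y - p x y) + ((x == u) + (x == v)).
    by rewrite -rowp -big_split; apply: eq_bigr => y _; apply: eE.
  have [||||K [N [symK symN leKN rowN rowK]]] := IHn (fun x y => e x y - p x y).
  - move: le_n; rewrite (eq_bigr _ (fun x _ => rowe x)) big_split /=.
    have: 0 < \sum_x ((x == u) + (x == v)) by rewrite (bigD1 u) //= eqxx.
    by rewrite ltnS; move=> lt0 /(leq_trans _); apply; rewrite -addn1 leq_add2l.
  - by move=> x y; rewrite syme p_sym.
  - by move=> x; rewrite loope.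
  - move=> x; have := dege x; have := rowe x; have [->|_] := eqVneq x u.
      by rewrite (negPf neq_uv) (eqP Wu) /=; lia.
    by have [->|_] := eqVneq x v; rewrite ?(eqP Wv) /=; lia.
  exists K, N; split=> // x y.
  by apply: leq_trans (leKN x y) (leq_subr _ _).
have indepW u v : W u -> W v -> e u v = 0.
  move=> Wu Wv; apply/eqP; rewrite -leqn0 leqNgt; apply: contra indep => euv.
  by apply/existsP; exists u; apply/existsP; exists v; rewrite euv Wu.
pose D u v := W u * e u v.
have rowD u : \sum_v D u v = W u * r.+1.
  by rewrite -big_distrr /= /W; case: eqP => // ->.
(* Rows of [W] sum to [r.+1] and [D2] takes at most [r] of that, so [D1] has exactly one arc leaving
   each vertex of [W]. By independence these arcs end outside [W], so forgetting their directions
   yields a matching. *)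
have [||D1 [D2 [DE rowD1 colD1 rowD2 _]]] := matrix_split V r 1 D.
- by move=> u; rewrite rowD addn1; case: (W u); rewrite ?mul1n ?mul0n.
- move=> v; rewrite addn1; apply: (@leq_trans (\sum_u e v u)); last first.
    by case/andP: (dege v).
  by apply: leq_sum => u _; rewrite /D syme; case: (W u); rewrite ?mul1n ?mul0n.
have leD1 u v : D1 u v <= D u v by rewrite DE leq_addr.
have D1W u v : W v -> D1 u v = 0.
  move=> Wv; apply/eqP; rewrite -leqn0; apply: leq_trans (leD1 u v) _.
  by rewrite /D; case: (boolP (W u)) => // Wu; rewrite indepW.
have D1nW u v : ~~ W u -> D1 u v = 0.
  by move=> nWu; apply/eqP; rewrite -leqn0; apply: leq_trans (leD1 u v) _; rewrite /D (negPf nWu).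
pose N u v := D1 u v + D1 v u.
have leN u v : N u v <= e u v.
  rewrite /N; have [Wv|nWv] := boolP (W v).
    rewrite D1W // add0n; apply: leq_trans (leD1 _ _) _.
    by rewrite /D Wv mul1n syme.
  rewrite (D1nW v u) // addn0; apply: leq_trans (leD1 _ _) _.
  by rewrite /D; case: (W u); rewrite ?mul1n.
have rowN v : \sum_w N v w = \sum_w D1 v w + \sum_w D1 w v by rewrite big_split.
have rowE v : \sum_w (e v w - N v w) + \sum_w N v w = \sum_w e v w.
  by rewrite -big_split; apply: eq_bigr => w _; rewrite /= subnK.
exists (fun u v => e u v - N u v), N; split.
- by move=> u v; rewrite syme /N addnC.
- by move=> u v; rewrite /N addnC.
- by move=> u v; rewrite subnK.
- move=> v; rewrite rowN; have [Wv|nWv] := boolP (W v).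
    by rewrite [X in _ + X]big1 ?addn0 // => w _; apply: D1W.
  by rewrite big1 ?add0n // => w _; apply: D1nW.
move=> v; rewrite rowE; case/andP: (dege v) => -> lev; rewrite andbT.
have rowD12 : \sum_w D1 v w + \sum_w D2 v w = W v * r.+1.
  by rewrite -rowD -big_split; apply: eq_bigr => w _; rewrite DE.
move: (rowE v) (rowN v) rowD12 (rowD2 v) lev.
by rewrite {1}/W; case: eqP => /=; lia.
Qed.

(** Each matching removed shifts the degree window down by one: no vertex loses more than one edge,
    and every vertex of top degree loses one. *)
Lemma near_regular_factor (V : finType) (f m : nat) (e : V -> V -> nat) :
    (forall u v, e u v = e v u) -> (forall v, e v v = 0) ->
    (forall v, f + m <= \sum_w e v w <= (f + m).+1) ->
  exists e1 : V -> V -> nat,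
    [/\ forall u v, e1 u v = e1 v u, forall u v, e1 u v <= e u v &
        forall v, f <= \sum_w e1 v w <= f.+1].
Proof.
move=> syme loope; elim: m => [|m IHm] in e syme loope * => dege.
  by exists e; split=> // v; have := dege v; rewrite addn0.
have [K [N [symK symN leKN rowN rowK]]] :=
  near_regular_matching V (f + m.+1) e syme loope dege.
have leKe u v : K u v <= e u v by have := leKN u v; lia.
have [//|v|v|e1 [syme1 le1 dege1]] := IHm K.
- by have := leKe v v; rewrite loope; lia.
- by have := rowK v; have := rowN v; lia.
by exists e1; split=> // u v; apply: leq_trans (le1 u v) _.
Qed.

(** * Balanced orientations and the oriented Petersen theorem *)

(** A list of pairs serves both as a multigraph and as an orientation of it; two lists with equal
    [edge_count] orient the same multigraph. Loops, which may arise when edges are merged, count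
    twice. *)
Definition edge_count (V : eqType) (s : seq (V * V)) (u v : V) : nat :=
  count_mem (u, v) s + count_mem (v, u) s.

Lemma edge_count_cons (V : eqType) (a b : V) (s : seq (V * V)) (u v : V) :
  edge_count V ((a, b) :: s) u v =
  (((a == u) && (b == v)) + ((a == v) && (b == u))) + edge_count V s u v.
Proof. by rewrite /edge_count /= !xpair_eqE addnACA. Qed.

Definition balanced (V : eqType) (s : seq (V * V)) : Prop := forall v,
  count (fun p => p.1 == v) s <= (count (fun p => p.2 == v) s).+1 /\
  count (fun p => p.2 == v) s <= (count (fun p => p.1 == v) s).+1.

(* Two edges ab, bc are replaced by ac: an orientation of ac lifts to a directed
   path through b, which does not change the imbalance of any vertex. *)
Lemma balanced_lift (V : eqType) (a b c : V) (s t : seq (V * V)) :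
    (forall u v, edge_count V t u v = edge_count V ((a, c) :: s) u v) ->
    balanced V t ->
  exists2 t', forall u v,
    edge_count V t' u v = edge_count V [:: (a, b), (b, c) & s] u v & balanced V t'.
Proof.
wlog act : a c s / (a, c) \in t => [IH tE balt | tE balt].
  have: 0 < edge_count V t a c by rewrite tE edge_count_cons !eqxx.
  rewrite addn_gt0 -!has_count !has_pred1 => /orP[act|cat]; first exact: IH act tE balt.
  have [u v|t' t'E balt'] := IH c a s cat _ balt.
    by rewrite tE !edge_count_cons [_ && _ + _]addnC [(a == u) && _]andbC [(a == v) && _]andbC.
  exists t' => // u v; rewrite t'E !edge_count_cons.
  rewrite [(c == u) && _]andbC [(c == v) && _]andbC [(b == u) && (a == _)]andbC [(b == v) && (a == _)]andbC.
  by lia.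
have /permP tP := perm_to_rem act; set t0 := rem _ t in tP.
exists [:: (a, b), (b, c) & t0] => [u v|v].
  have := tE u v; rewrite {1}/edge_count !tP -/(edge_count V ((a, c) :: t0) u v).
  by rewrite !edge_count_cons; lia.
by have [] := balt v; rewrite !tP /=; lia.
Qed.

(** Induction on the number of edges: the first edge is merged with another edge sharing an
    endpoint; if there is none, it is isolated and any direction will do. *)
Lemma balanced_orientation (V : eqType) (s : seq (V * V)) :
  exists2 t, forall u v, edge_count V t u v = edge_count V s u v & balanced V t.
Proof.
have [n] := ubnP (size s); elim: n s => // n IHn [|[a b] s] les; first by exists nil.
(* The edge [p] joins [y] to some [c], so [xy] and [yc] merge into [xc], which leaves one edge
   fewer. *)
have touch x y p : p \in s -> (p.1 == y) || (p.2 == y) -> exists2 t,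
    forall u v, edge_count V t u v = edge_count V ((x, y) :: s) u v & balanced V t.
  move=> ps py; have /permP sP := perm_to_rem ps.
  pose c := if p.1 == y then p.2 else p.1.
  have pE s0 u v : edge_count V (p :: s0) u v = edge_count V ((y, c) :: s0) u v.
    rewrite /c; case: (p) py => p1 p2 /=; rewrite !edge_count_cons.
    have [->//|_ /= /eqP->] := eqVneq p1 y; congr (_ + _).
    by rewrite [(y == u) && _]andbC [(y == v) && _]andbC addnC.
  have [|t tE balt] := IHn ((x, c) :: rem p s).
    by move: les; rewrite /= size_rem //; case: (s) ps => //=; lia.
  have [t' t'E balt'] := balanced_lift V x y c _ t tE balt.
  exists t' => // u v; rewrite t'E 2!edge_count_cons [RHS]edge_count_cons; congr (_ + _).
  by rewrite [RHS]/edge_count !sP -/(edge_count V (p :: _) u v) pE edge_count_cons.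
have [/hasP[p ps pb]|nb] := boolP (has (fun p => (p.1 == b) || (p.2 == b)) s).
  exact: touch ps pb.
have [/hasP[p ps pa]|na] := boolP (has (fun p => (p.1 == a) || (p.2 == a)) s).
  have [t tE balt] := touch b a p ps pa; exists t => // u v.
  rewrite tE !edge_count_cons; congr (_ + _).
  by rewrite addnC [(b == v) && _]andbC [(b == u) && _]andbC.
have [//|t tE balt] := IHn s.
have isol x : ~~ has (fun p => (p.1 == x) || (p.2 == x)) s ->
    count (fun p => p.1 == x) t = 0 /\ count (fun p => p.2 == x) t = 0.
  move=> nx; suff nt p : p \in t -> ~~ ((p.1 == x) || (p.2 == x)).
    by split; apply/eqP; rewrite -leqn0 leqNgt -has_count;
      apply/hasPn => p /nt; rewrite negb_or => /andP[].
  case: p => p1 p2 pt; have: 0 < edge_count V s p1 p2.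
    by rewrite -tE addn_gt0 -has_count has_pred1 pt.
  rewrite addn_gt0 -!has_count !has_pred1 => /orP[]ps;
    by have := hasPn nx _ ps; rewrite //= orbC.
exists ((a, b) :: t) => [u v|v]; first by rewrite !edge_count_cons tE.
have := balt v; rewrite /=; have [<-|_] := eqVneq a v.
  by have [-> ->] := isol a na; case: eqP.
by have [<-|_] := eqVneq b v => //; have [-> ->] := isol b nb.
Qed.

(** In a balanced orientation the in- and out-degree differ by at most 1 and sum to at most [s.*2],
    so neither exceeds [s]. *)
Lemma eulerian_orientation (V : finType) (s : nat) (e : V -> V -> nat) :
    (forall u v, e u v = e v u) -> (forall v, e v v = 0) ->
    (forall v, \sum_w e v w <= s.*2) ->
  exists D : V -> V -> nat,
    [/\ forall u v, D u v + D v u = e u v,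
        forall v, \sum_w D v w <= s & forall v, \sum_w D w v <= s].
Proof.
move=> syme loope dege.
(* Comparing ranks lists each edge in one direction only. *)
pose A u v := (enum_rank u < enum_rank v) * e u v.
pose L := flatten [seq nseq (A p.1 p.2) p | p <- index_enum (V * V)%type].
have countL u v : count_mem (u, v) L = A u v.
  rewrite count_flatten sumnE !big_map -(sum_delta _ (u, v) (fun p => A p.1 p.2)).
  by apply: eq_bigr => p _; rewrite count_nseq /=.
have AE u v : A u v + A v u = e u v.
  rewrite /A [e v u]syme; case: ltngtP => [_|_|/val_inj/enum_rank_inj->];
    by rewrite ?loope; lia.
have [t tE balt] := balanced_orientation _ L.
pose D u v := count_mem (u, v) t.
have DE u v : D u v + D v u = e u v by rewrite -AE -!countL; apply: tE.
have outD v : \sum_w D v w = count (fun p => p.1 == v) t.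
  rewrite /D; elim: (t) => [|[a b] t' IHt] /=; first by rewrite big1.
  rewrite big_split /= IHt; congr (_ + _); rewrite -(sum_arc_row _ v b a).
  by rewrite /arc; apply: eq_bigr => w _; rewrite xpair_eqE [b == w]eq_sym.
have inD v : \sum_w D w v = count (fun p => p.2 == v) t.
  rewrite /D; elim: (t) => [|[a b] t' IHt] /=; first by rewrite big1.
  rewrite big_split /= IHt; congr (_ + _); rewrite -(sum_arc_col _ a v b).
  by rewrite /arc; apply: eq_bigr => w _; rewrite xpair_eqE [a == w]eq_sym.
have degD v : \sum_w D v w + \sum_w D w v = \sum_w e v w.
  by rewrite -big_split; apply: eq_bigr => w _; apply: DE.
by exists D; split=> // v; have := degD v; have := dege v; have := balt v;
  rewrite outD inD; lia.
Qed.

(** An orientation with in- and out-degrees at most [j + k] is split as a matrix; the [k] part stays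
    oriented, and the [j] part loses its directions. *)
Lemma oriented_petersen (V : finType) (j k : nat) (e : V -> V -> nat) :
    (forall u v, e u v = e v u) -> (forall v, e v v = 0) ->
    (forall v, \sum_w e v w <= (j + k).*2) ->
  exists E D : V -> V -> nat,
    [/\ forall u v, E u v = E v u, forall u v, e u v = E u v + (D u v + D v u),
        forall v, \sum_w E v w <= j.*2 & forall v, \sum_w D w v <= k].
Proof.
move=> syme loope dege.
have [A [AE outA inA]] := eulerian_orientation V (j + k) e syme loope dege.
have [D1 [D2 [A12 _ colD1 rowD2 colD2]]] := matrix_split V j k A outA inA.
exists (fun u v => D2 u v + D2 v u), D1; split=> // [u v|u v|v].
- exact: addnC.
- by rewrite -AE !A12; lia.
- by rewrite big_split /= -addnn leq_add.
Qed.

(** * Construction of the fixed part [E] and the oriented part [D] *)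

Lemma near_regular_interval (V : finType) (r f g : nat) (e : V -> V -> nat) :
    (forall u v, e u v = e v u) -> (forall v, e v v = 0) ->
    (forall v, r <= \sum_w e v w <= r.+1) -> 0 < g <= f -> f <= r ->
  exists2 k, k.*2 + g <= f.+2 & exists E D : V -> V -> nat,
    [/\ forall u v, E u v = E v u, forall u v, E u v + (D u v + D v u) <= e u v,
        forall v, \sum_w E v w <= g,
        forall v, f <= \sum_w E v w + (\sum_w D v w + \sum_w D w v) &
        forall v, \sum_w D w v <= k].
Proof.
move=> syme loope dege /andP[g_gt0 le_gf] le_fr.
have [||e1 [syme1 le1 dege1]] := near_regular_factor V f (r - f) e syme.
- by [].
- by rewrite subnKC.
have loope1 v : e1 v v = 0 by have := le1 v v; rewrite loope; lia.
have [f_odd|f_even] := boolP (odd f).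
  (* [f.+1] is even, so [e1] splits into [f.+1./2] classes; [E] takes [g./2] of them, which keeps
     its degrees at most [g]. *)
  have [||E [D [symE e1E degE inD]]] := oriented_petersen V g./2 (f.+1./2 - g./2) e1 syme1.
  - by [].
  - by move=> v; have := dege1 v; lia.
  exists (f.+1./2 - g./2); first by lia.
  exists E, D; split=> //.
  - by move=> u v; rewrite -e1E.
  - by move=> v; have := degE v; lia.
  - move=> v; rewrite -!big_split /=; have /andP[+ _] := dege1 v.
    by under eq_bigr do rewrite e1E.
have [K [N [symK symN leKN degN degK]]] := near_regular_matching V f e1 syme1 loope1 dege1.
have leK u v : K u v <= e1 u v by have := leKN u v; lia.
(* [E] takes [g.-1./2] classes, because the matching [N] added to it costs one more degree; this is
   where [0 < g] matters. *)
have [||E [D [symE KE degE inD]]] :=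
  oriented_petersen V g.-1./2 (f./2 - g.-1./2) K symK.
- by move=> v; have := leK v v; rewrite loope1; lia.
- by move=> v; have := degK v; lia.
have degEN v : \sum_w (E v w + N v w) = \sum_w E v w + \sum_w N v w by rewrite big_split.
exists (f./2 - g.-1./2); first by lia.
exists (fun u v => E u v + N u v), D; split=> //.
- by move=> u v; rewrite symE symN.
- by move=> u v; apply: leq_trans (le1 u v); apply: leq_trans (leKN u v); rewrite KE; lia.
- by move=> v; rewrite degEN; have := degE v; have := degN v; lia.
- move=> v; rewrite degEN; have /andP[_] := degK v.
  by under eq_bigr do rewrite KE; rewrite !big_split /=; lia.
Qed.

(** * Greedy completion of a partial factor *)

(* As long as the current degree c v is forbidden, some arc leaves v, and adding
   it to the factor raises the degrees at both ends while keeping the hypothesis: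
   at v only a forbidden value is lost, at the head the in-degree drops. *)
Lemma oriented_greedy_factor (V : finType) (P : V -> pred nat)
    (D : V -> V -> nat) (c : V -> nat) :
    (forall v, D v v = 0) ->
    (forall v, \sum_w D w v <
       count (P v) (iota (c v) (\sum_w D v w + \sum_w D w v).+1)) ->
  exists F : V -> V -> nat,
    [/\ forall u v, F u v = F v u, forall u v, F u v <= D u v + D v u &
        forall v, P v (c v + \sum_w F v w)].
Proof.
have [n] := ubnP (\sum_u \sum_v D u v).
elim: n D c => // n IHn D c le_n loopD manyP.
have [/forallP Pc|/forallPn[v nPv]] := boolP [forall v, P v (c v)].
  by exists (fun _ _ => 0); split=> // v; rewrite big1 // addn0.
(* Without the forbidden value [c v], the interval has as many values as the out-degree plus the
   in-degree of [v]; more than the in-degree are allowed, so the out-degree is positive. *)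
have /= := manyP v; rewrite (negPf nPv) add0n => /leq_trans/(_ (count_size _ _)).
rewrite size_iota -[X in X < _]add0n ltn_add2r lt0n sum_nat_eq0 => /forallPn[w /=].
rewrite -lt0n => Dvw.
have neq_wv : w != v by apply: contraTneq Dvw => ->; rewrite loopD.
pose D' x y := D x y - arc V v w x y.
have DE x y : D x y = D' x y + arc V v w x y.
  by rewrite subnK // /arc; case: eqP => // ->; case: eqP => // ->.
have outD x : \sum_y D x y = \sum_y D' x y + (x == v).
  by rewrite -(sum_arc_row _ v w) -big_split; apply: eq_bigr => y _; apply: DE.
have inD y : \sum_x D x y = \sum_x D' x y + (y == w).
  by rewrite -(sum_arc_col _ v w) -big_split; apply: eq_bigr => x _; apply: DE.
have [|||F [symF leF PF]] := IHn D' (fun x => c x + ((x == v) + (x == w))).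
- move: le_n; rewrite (eq_bigr _ (fun x _ => outD x)) big_split /=.
  by rewrite (bigD1 v (F := fun x => _ (x == v))) //= eqxx; lia.
- by move=> x; rewrite /D' loopD.
- move=> x; have := manyP x; rewrite outD inD.
  have [->|nxv] := eqVneq x v.
    by rewrite eq_sym (negPf neq_wv) /= !addn0 !addn1 addSn /= (negPf nPv).
  have [->|nxw] := eqVneq x w; rewrite ?addn0 //=.
  by rewrite !addn1 addnS /=; case: (P w (c w)); lia.
exists (fun x y => F x y + (arc V v w x y + arc V w v x y)); split.
- by move=> x y; rewrite symF /arc; congr (_ + _); rewrite addnC ![(y == _) && _]andbC.
- move=> x y; have := leF x y; rewrite !DE.
  by rewrite [arc V w v x y]/arc andbC -/(arc V v w y x); lia.
- move=> x; have := PF x; rewrite !big_split /= !sum_arc_row.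
  by rewrite -addnA [X in c x + X]addnC.
Qed.

(** * Bounds on the prescribed degrees, and the theorem *)

Lemma bigmin_leq_seed (I : Type) (s : seq I) (F : I -> nat) (m : nat) :
  \big[minn/m]_(i <- s) F i <= m.
Proof.
by elim/big_rec: _ => // i x _ lexm; apply: leq_trans (geq_minr _ _) lexm.
Qed.

Lemma bigmin_leq (I : eqType) (s : seq I) (F : I -> nat) (m : nat) (i : I) :
  i \in s -> \big[minn/m]_(j <- s) F j <= F i.
Proof.
elim: s => // j s IHs; rewrite inE big_cons => /predU1P[->|/IHs]; first exact: geq_minl.
by apply: leq_trans (geq_minr _ _).
Qed.

Lemma mH_leq (V : finType) (H : V -> {fset nat}) (v : V) (k : nat) :
  k \in H v -> mH H <= k.
Proof.
move=> Hk; apply: (@leq_trans (fset_min (H v))); last exact: bigmin_leq Hk.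
by apply: bigmin_leq; apply: mem_index_enum.
Qed.

Lemma leq_MH (V : finType) (H : V -> {fset nat}) (v : V) (k : nat) :
  k \in H v -> k <= MH H.
Proof.
move=> Hk; apply: leq_trans (leq_bigmax v).
exact: (leq_bigmax_seq k (F := id)).
Qed.

Lemma degree_sum (V : finType) (G : simple_graph V) (v : V) :
  degree G v = \sum_w G v w.
Proof.
by rewrite /degree -sum1_card big_mkcond; apply: eq_bigr => w _; rewrite inE; case: (G v w).
Qed.

Theorem theorem1p11 (r : nat) (V : finType) (G : simple_graph V)
    (H : V -> {fset nat})
    (r_pos : 0 < r)
    (degG : forall v : V, degree G v = r \/ degree G v = r.+1)
    (H_sub : forall (v : V) (k : nat), k \in H v -> k <= degree G v)
    (H_neq0 : forall v : V, H v != fset0)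
    (mH_ge1 : 1 <= mH H)
    (MH_le : MH H <= r)
    (card_H : forall v : V,
       (((MH H)%:R - (mH H)%:R + 3%:R) / 2%:R <= (#|` H v|)%:R :> rat)%R) :
  has_factor H G.
Proof.
pose f := MH H; pose g := mH H.
pose e u v : nat := G u v.
have [u v|v|v||k le_k [E [D [symE leED degE degED inD]]]] :=
  near_regular_interval V r f g e _ _ _ _ MH_le.
- by rewrite /e adj_sym.
- by rewrite /e adj_irrefl.
- by rewrite -degree_sum; case: (degG v) => ->; rewrite leqnn ?leqnSn.
- by rewrite mH_ge1 bigmin_leq_seed.
have card_gt v : k < #|` H v|.
  (* Clearing denominators turns [card_H] into an inequality over [nat], which exceeds
     [k.*2 + g <= f.+2] by one. *)
  have: f + 3 <= #|` H v| * 2 + g.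
    move: (card_H v); rewrite Num.Theory.ler_pdivrMr ?Num.Theory.ltr0n //.
    rewrite GRing.addrAC Num.Theory.lerBlDr.
    by rewrite -GRing.natrM -!GRing.natrD Num.Theory.ler_nat.
  by lia.
have [v|v|F [symF leF FP]] :=
  oriented_greedy_factor V (fun v => [pred h | h \in H v]) D (fun v => \sum_w E v w).
- by have := leED v v; rewrite /e adj_irrefl; lia.
(* All of [H v] lies in the interval from [g] to [f], hence in the range of degrees from [E] alone
   to [E] with all of [D], so the count is at least the size of [H v]. *)
- apply: leq_ltn_trans (inD v) (leq_trans (card_gt v) _).
  rewrite -size_filter; apply: uniq_leq_size => [|h Hh]; first exact: fset_uniq.
  rewrite mem_filter mem_iota /= Hh /=.
  have := mH_leq V H v h Hh; have := leq_MH V H v h Hh.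
  by have := degE v; have := degED v; rewrite -/f -/g; lia.
(* [F] stays below [D] plus its transpose, so [E + F] is bounded by the 0/1 matrix of [G] and is
   itself an adjacency matrix. *)
pose X u v := 0 < E u v + F u v.
have XE u v : X u v = E u v + F u v :> nat.
  by have := leED u v; have := leF u v; rewrite /X /e; case: (G u v); lia.
have leXG u v : (X u v : nat) <= G u v.
  by rewrite XE; apply: leq_trans (leED u v); rewrite leq_add2l.
have symX : symmetric X by move=> u v; rewrite /X symE symF.
have irrX : irreflexive X.
  by move=> v; have := leXG v v; rewrite adj_irrefl; case: (X v v).
exists (SimpleGraph symX irrX); split=> [u v /= Xuv|v].
  by have := leXG u v; rewrite Xuv; case: (G u v).
rewrite degree_sum /= (eq_bigr _ (fun w _ => XE v w)) big_split /=.
exact: FP.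
Qed.
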